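(* Let $\mathcal{RS}$ be a Riemann solver for a node $J$ with two incoming arcs (indices $1,2$) and two outgoing arcs (indices $3,4$), with flux $f$, and let $(\bar\rho_1,\bar\rho_2,\bar\rho_3,\bar\rho_4)$ be an equilibrium for $\mathcal{RS}$ with $\bar\rho_1\le\bar\rho_2$ and $\bar\rho_3\le\bar\rho_4$. Assume that every $\bar\rho_l$, $l\in\{1,2,3,4\}$, is a good datum. 1. If $\mathcal F(\mathcal{RS}(\rho_{1,0},\dots,\rho_{4,0}),k)\ge0$ for every initial datum $(\rho_{1,0},\dots,\rho_{4,0})\in[0,1]^4$ and every $k\in[0,1]$, then $\bar\rho_1=\bar\rho_2=\bar\rho_3=\bar\rho_4=\sigma$. 2. If $\bar\rho_1=\bar\rho_2=\bar\rho_3=\bar\rho_4=\sigma$, then $\mathcal F(\bar\rho_1,\bar\rho_2,\bar\rho_3,\bar\rho_4,k)=0$ for every $k\in[0,1]$.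
   Context: Flux: $f:[0,1]\to\mathbb R$ is a continuous, piecewise smooth, concave function with $f(0)=f(1)=0$, and there is a unique $\sigma\in\,]0,1[$ such that $f$ is strictly increasing on $[0,\sigma[$ and strictly decreasing on $]\sigma,1]$. Let $\tau:[0,1]\to[0,1]$ be the map with $f(\tau(\rho))=f(\rho)$ for all $\rho\in[0,1]$ and $\tau(\rho)\neq\rho$ for all $\rho\ne\sigma$. Convention: $\mathrm{sgn}(0)=0$. Riemann solver (two incoming, two outgoing arcs): a function $\mathcal{RS}:[0,1]^4\to[0,1]^4$, $(\rho_{1,0},\dots,\rho_{4,0})\mapsto(\bar\rho_1,\dots,\bar\rho_4)$, such that for every initial datum: (1) $f(\bar\rho_1)+f(\bar\rho_2)=f(\bar\rho_3)+f(\bar\rho_4)$; (2) for $i\in\{1,2\}$ the classical Riemann problem for $\rho_t+f(\rho)_x=0$ with left state $\rho_{i,0}$ and right state $\bar\rho_i$ is solved with waves with negative speed; that is, $\bar\rho_i\in\{\rho_{i,0}\}\cup\,]\tau(\rho_{i,0}),1]$ if $\rho_{i,0}\le\sigma$ and $\bar\rho_i\in[\sigma,1]$ if $\rho_{i,0}\ge\sigma$; (3) for $j\in\{3,4\}$ the classical Riemann problem with left state $\bar\rho_j$ and right state $\rho_{j,0}$ is solved with waves with positive speed; that is, $\bar\rho_j\in[0,\sigma]$ if $\rho_{j,0}\le\sigma$ and $\bar\rho_j\in\{\rho_{j,0}\}\cup[0,\tau(\rho_{j,0})[$ if $\rho_{j,0}\ge\sigma$. An equilibrium for $\mathcal{RS}$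 is a fixed point of $\mathcal{RS}$. Good and bad data: a datum $\rho$ in an incoming arc is good if $\rho\in[\sigma,1]$ and bad if $\rho\in[0,\sigma[$; a datum $\rho$ in an outgoing arc is good if $\rho\in[0,\sigma]$ and bad if $\rho\in\,]\sigma,1]$. Entropy-flux function: $\mathcal F(\rho_1,\rho_2,\rho_3,\rho_4,k)=\sum_{i=1}^2\mathrm{sgn}(\rho_i-k)(f(\rho_i)-f(k))-\sum_{j=3}^4\mathrm{sgn}(\rho_j-k)(f(\rho_j)-f(k))$. (E1): $\mathcal{RS}$ satisfies (E1) if $\mathcal F(\mathcal{RS}(\rho_{1,0},\dots,\rho_{4,0}),k)\ge0$ for every initial datum $(\rho_{1,0},\dots,\rho_{4,0})\in[0,1]^4$ and every $k\in[0,1]$. *)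

(* Defs.v *)
From mathcomp Require Import all_boot all_order all_algebra.
From mathcomp Require Import all_classical all_reals all_analysis.
Set Implicit Arguments.
Unset Strict Implicit.
Unset Printing Implicit Defensive.
Import Order.TTheory GRing.Theory Num.Theory.
Import numFieldNormedType.Exports.
Local Open Scope classical_set_scope.
Local Open Scope ring_scope.

(* C^oo on the open pieces of a finite subdivision of [a, b]; one-sided
   derivatives need not exist at the nodes, so that kinks and vertical tangents
   are both allowed. *)
Definition piecewise_smooth (R : realType) (a b : R) (f : R -> R) : Prop :=
  exists2 s : seq R, itv_partition a b s &
    forall i, (i < size s)%N ->
      forall x, x \in `]nth b (a :: s) i, nth b (a :: s) i.+1[ ->
        forall n, derivable (derive1n n f) x 1.

Definition unimodal_at (R : realType) (f : R -> R) (sigma : R) : Prop :=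
  [/\ sigma \in `]0, 1[,
      {in `[0, sigma[ &, {homo f : x y / x < y}} &
      {in `]sigma, 1] &, {homo f : x y /~ x < y}}].

(* Functions on [0, 1] (resp. on [0, 1]^4) are represented by functions on R
   (resp. on R^4) whose values outside that domain are irrelevant. *)
Record is_flux (R : realType) (f : R -> R) (sigma : R) : Prop := IsFlux {
  flux_continuous : {within `[0, 1], continuous f};
  flux_piecewise_smooth : piecewise_smooth 0 1 f;
  flux_concave : @convex_function R R^o `[0 : R, 1]%classic (\- f);
  flux0 : f 0 = 0;
  flux1 : f 1 = 0;
  flux_unimodal : unique (unimodal_at f) sigma }.

Record is_tau (R : realType) (f : R -> R) (sigma : R) (tau : R -> R) : Prop :=
  IsTau {
  tau_itv : {in `[0, 1], forall r, tau r \in `[0, 1]};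
  tau_flux : {in `[0, 1], forall r, f (tau r) = f r};
  tau_neq : {in `[0, 1], forall r, r <> sigma -> tau r <> r} }.

Definition quad (R : realType) : Type := (R * R * R * R)%type.

Definition in_cube (R : realType) (r : quad R) : Prop :=
  let '(r1, r2, r3, r4) := r in
  [/\ r1 \in `[0, 1], r2 \in `[0, 1], r3 \in `[0, 1] & r4 \in `[0, 1]].

Definition negative_waves (R : realType) (sigma : R) (tau : R -> R)
    (r0 r : R) : Prop :=
  (r0 <= sigma -> r = r0 \/ r \in `]tau r0, 1]) /\
  (sigma <= r0 -> r \in `[sigma, 1]).

Definition positive_waves (R : realType) (sigma : R) (tau : R -> R)
    (r r0 : R) : Prop :=
  (r0 <= sigma -> r \in `[0, sigma]) /\
  (sigma <= r0 -> r = r0 \/ r \in `[0, tau r0[).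

(* Arcs 1 and 2 are incoming, arcs 3 and 4 are outgoing. *)
Definition is_riemann_solver (R : realType) (f : R -> R) (sigma : R)
    (tau : R -> R) (RS : quad R -> quad R) : Prop :=
  forall r0 : quad R, in_cube r0 ->
    in_cube (RS r0) /\
    let '(r10, r20, r30, r40) := r0 in
    let '(r1, r2, r3, r4) := RS r0 in
    [/\ f r1 + f r2 = f r3 + f r4,
        negative_waves sigma tau r10 r1 /\ negative_waves sigma tau r20 r2 &
        positive_waves sigma tau r3 r30 /\ positive_waves sigma tau r4 r40].

Definition equilibrium (R : realType) (RS : quad R -> quad R) (r : quad R) :
  Prop := in_cube r /\ RS r = r.

Definition good_incoming (R : realType) (sigma r : R) : Prop :=
  r \in `[sigma, 1].

Definition good_outgoing (R : realType) (sigma r : R) : Prop :=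
  r \in `[0, sigma].

Definition entropy_flux (R : realType) (f : R -> R) (r : quad R) (k : R) : R :=
  let '(r1, r2, r3, r4) := r in
  (Num.sg (r1 - k) * (f r1 - f k) + Num.sg (r2 - k) * (f r2 - f k))
  - (Num.sg (r3 - k) * (f r3 - f k) + Num.sg (r4 - k) * (f r4 - f k)).

Definition E1 (R : realType) (f : R -> R) (RS : quad R -> quad R) : Prop :=
  forall r0 : quad R, in_cube r0 ->
    forall k : R, k \in `[0, 1] -> 0 <= entropy_flux f (RS r0) k.

(* Main.v *)
Require Import Defs.
From mathcomp Require Import all_boot all_order all_algebra.
From mathcomp Require Import all_classical all_reals all_analysis.
Import Order.TTheory GRing.Theory Num.Theory.
Import numFieldNormedType.Exports.
Local Open Scope classical_set_scope.
Local Open Scope ring_scope.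

(** The entropy condition is tested on the equilibrium itself, at the level
[k = sigma]. There every term has a sign: good data satisfy
[r3, r4 <= sigma <= r1, r2] while [sigma] is the maximum point of [f], so each
incoming arc contributes [f r - f sigma <= 0] and each outgoing arc, whose sign
factor is negative but which is counted with a minus, contributes the same. Hence
(E1) forces a sum of nonpositive terms to be nonnegative, all of them vanish,
and they vanish only at [sigma] because the maximum is strict
([flux_lt_max]). Conversely, when the four data coincide, the incoming
and outgoing entropy fluxes cancel whatever [k] is. *)

(** The monotonicity of a flux is prescribed only away from the peak; it is
continuity that makes the value at the peak dominate: [f sigma] is the
one-sided limit of values above [f a], for some [a] strictly between [r] and
[sigma]. *)
Lemma flux_lt_max {R : realType} {f : R -> R} {sigma r : R} :
  is_flux f sigma -> r \in `[0, 1] -> r != sigma -> f r < f sigma.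
Proof.
move=> hf; rewrite in_itv /= => /andP[r0 r1].
have [[+ finc fdec] _] := flux_unimodal hf.
rewrite in_itv /= => /andP[s0 s1].
have fs : {for sigma, continuous f}.
  have [+ _ _] := (continuous_within_itvP f ltr01).1 (flux_continuous hf).
  by apply; rewrite in_itv /= s0 s1.
rewrite neq_lt => /orP[rs|sr].
- have [ra as_] := midf_lt rs; set a := (r + sigma) / 2 in ra as_.
  have a0 : 0 <= a by apply: le_trans r0 (ltW ra).
  apply: (@lt_le_trans _ _ (f a)).
    by apply: finc; rewrite ?in_itv /= ?r0 ?rs ?a0 ?as_.
  have fl : f x @[x --> sigma^'-] --> f sigma by apply: cvg_at_left_filter.
  rewrite -(cvg_lim (@Rhausdorff R) fl).
  apply: limr_ge; first by apply/cvg_ex; exists (f sigma).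
  near=> x.
  have ax : a < x by near: x; apply: nbhs_left_gt.
  have xs : x < sigma by near: x; apply: nbhs_left_lt.
  by apply/ltW/finc; rewrite ?in_itv /= ?a0 ?as_ ?xs ?(le_trans a0 (ltW ax)).
- have [sa ar] := midf_lt sr; set a := (sigma + r) / 2 in sa ar.
  have a1 : a <= 1 by apply: le_trans (ltW ar) r1.
  apply: (@lt_le_trans _ _ (f a)).
    by apply: fdec; rewrite ?in_itv /= ?r1 ?sr ?a1 ?sa.
  have fr : f x @[x --> sigma^'+] --> f sigma by apply: cvg_at_right_filter.
  rewrite -(cvg_lim (@Rhausdorff R) fr).
  apply: limr_ge; first by apply/cvg_ex; exists (f sigma).
  near=> x.
  have xa : x < a by near: x; apply: nbhs_right_lt.
  have sx : sigma < x by near: x; apply: nbhs_right_gt.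
  by apply/ltW/fdec; rewrite ?in_itv /= ?a1 ?sa ?sx ?(le_trans (ltW xa) a1).
Unshelve. all: by end_near.
Qed.

(** Goodness fixes the sign of [r - sigma] while the maximality of [f sigma]
fixes that of the flux gap. Stating the bound as a conditional equality lets
the contributions of the arcs be added without losing the rigidity of the
equality case. *)
Lemma incoming_entropy_leif {R : realType} {f : R -> R} {sigma r : R} :
  is_flux f sigma -> r \in `[0, 1] -> good_incoming sigma r ->
  Num.sg (r - sigma) * (f r - f sigma) <= 0 ?= iff (r == sigma).
Proof.
move=> hf r01; rewrite /good_incoming in_itv /= => /andP[sr _].
have [->|rs] := eqVneq r sigma.
  by rewrite !subrr mulr0; split; rewrite ?lexx ?eqxx.
have flt := flux_lt_max hf r01 rs.
have s_lt_r : sigma < r by rewrite lt_neqAle eq_sym rs.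
rewrite gtr0_sg ?subr_gt0 // mul1r.
by split; rewrite ?subr_le0 ?(ltW flt) // subr_eq0 lt_eqF.
Qed.

Lemma outgoing_entropy_leif {R : realType} {f : R -> R} {sigma r : R} :
  is_flux f sigma -> r \in `[0, 1] -> good_outgoing sigma r ->
  - (Num.sg (r - sigma) * (f r - f sigma)) <= 0 ?= iff (r == sigma).
Proof.
move=> hf r01; rewrite /good_outgoing in_itv /= => /andP[_ rs].
have [->|rNs] := eqVneq r sigma.
  by rewrite !subrr mulr0 oppr0; split; rewrite ?lexx ?eqxx.
have flt := flux_lt_max hf r01 rNs.
have r_lt_s : r < sigma by rewrite lt_neqAle rNs.
rewrite ltr0_sg ?subr_lt0 // mulN1r opprK.
by split; rewrite ?subr_le0 ?(ltW flt) // subr_eq0 lt_eqF.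
Qed.

Theorem proposition4p2 (R : realType) (f : R -> R) (sigma : R) (tau : R -> R)
    (RS : quad R -> quad R) (r1 r2 r3 r4 : R)
    (hf : is_flux f sigma) (htau : is_tau f sigma tau)
    (hRS : is_riemann_solver f sigma tau RS)
    (heq : equilibrium RS (r1, r2, r3, r4))
    (h12 : r1 <= r2) (h34 : r3 <= r4)
    (hgood : [/\ good_incoming sigma r1, good_incoming sigma r2,
                 good_outgoing sigma r3 & good_outgoing sigma r4]) :
  (E1 f RS -> [/\ r1 = sigma, r2 = sigma, r3 = sigma & r4 = sigma]) /\
  ([/\ r1 = sigma, r2 = sigma, r3 = sigma & r4 = sigma] ->
     forall k : R, k \in `[0, 1] -> entropy_flux f (r1, r2, r3, r4) k = 0).
Proof.
split=> [hE|[-> -> -> ->] k _]; last exact: subrr.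
have [cube RSr] := heq.
have [c1 c2 c3 c4] := cube; have [g1 g2 g3 g4] := hgood.
have s01 : sigma \in `[0, 1].
  by have [[/subset_itv_oo_cc]] := flux_unimodal hf.
have := hE _ cube _ s01; rewrite RSr /entropy_flux opprD.
have := leifD
  (leifD (incoming_entropy_leif hf c1 g1) (incoming_entropy_leif hf c2 g2))
  (leifD (outgoing_entropy_leif hf c3 g3) (outgoing_entropy_leif hf c4 g4)).
rewrite !addr0 => /ge_leif-> /andP[/andP[/eqP-> /eqP->] /andP[/eqP-> /eqP->]].
by [].
Qed.
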